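(* Let $\widetilde{\Sigma}_1,\widetilde{\Sigma}_2$ be disjoint visibly pushdown alphabets, $\widetilde{\Sigma}=\widetilde{\Sigma}_1\uplus\widetilde{\Sigma}_2$, and let $P_1,P_2$ be visibly pushdown automata over $\widetilde{\Sigma}_1,\widetilde{\Sigma}_2$ with $n_1,n_2$ states and stack alphabets $\Gamma_1,\Gamma_2$, recognizing well-matched languages. Let $\prec$ be a visibly pushdown contextual order on $\widetilde{\Sigma}$ represented by a visibly pushdown automaton $A$ with $n_A$ states, and suppose $\prec$ is uniform with respect to $P_1,P_2$. Let $n_\Gamma=|\Gamma_1|+|\Gamma_2|$. Then $\mathrm{red}_\prec(\mathcal{L}(P_1)\bowtie\mathcal{L}(P_2))$ is recognized by a visibly pushdown automaton with $O(n_1n_2n_An_\Gamma)$ states.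
   Context: A visibly pushdown (VP) alphabet is a finite alphabet partitioned into calls, returns and internals; $\widetilde{\Sigma}$ has as calls/returns/internals the unions. Calls and returns in a word are matched like opening and closing parentheses (internals ignored); unmatched ones are pending; a word is well-matched if none are pending. A visibly pushdown automaton (VPA) $(Q,Q^{\mathsf{in}},\Gamma,\delta,Q^{\mathsf F})$ has a stack alphabet $\Gamma$ containing a bottom symbol $\bot$; call transitions push a symbol of $\Gamma\setminus\{\bot\}$, return transitions pop the top symbol (reading $\bot$ on empty stack), internal transitions leave the stack unchanged; it accepts when ending in $Q^{\mathsf F}$. It is deterministic if it has one initial state and at most one transition per configuration and letter, complete if at least one. A letter is an outgoing letter of a state $q$ if some transition from $q$ reads it. Shuffle $L_1\parallel L_2=\{w\in\widetilde{\Sigma}^*:\Pi_{\widetilde{\Sigma}_i}(w)\in L_i\}$, $\Pi_{\widetilde{\Sigma}_i}$ erasing letters outside $\widetilde{\Sigma}_i$; a word is well-nested if every matched call–return pair consists of letters from the same $\widetilde{\Sigma}_k$; $L_1\bowtie L_2$ is the set of well-nested words of $L_1\parallel L_2$. $\mathbb{I}=\{(a,b):a\in\widetilde{\Sigma}_i,b\in\widetilde{\Sigma}_j,i\ne j\}$, $\equiv_{\mathbb{I}}$ the least reflexive transitive relation with $uabv\equiv_{\mathbb{I}}ubav$ for $(a,b)\in\mathbb{I}$. A contextual order is a map $\prec$ from $\widetilde{\Sigma}^*$ to strict total orders on $\widetilde{\Sigma}$; it induces $\preceq$: $\sigma\preceq\rho$ iff $\sigma$ is a prefix of $\rho$ or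 $\sigma=\alpha a\beta$, $\rho=\alpha b\gamma$ with $a\prec_\alpha b$. $\mathrm{red}_\prec(L)=\{w\in L:\forall u\in L,(u\equiv_{\mathbb{I}}w\wedge u\preceq w)\Rightarrow u=w\}$. $\prec$ is represented by a VPA $A$ (and is then called visibly pushdown) if $A$ is a complete deterministic VPA over $\widetilde{\Sigma}$ and there is a map $\mathsf{ord}$ from states of $A$ to strict total orders on $\widetilde{\Sigma}$ with $\prec_w=\mathsf{ord}(q)$, $q$ the state reached by $A$ after reading $w$. $\prec$ is uniform w.r.t. $P_1,P_2$ if for every state $q_1$ of $P_1$, state $q_2$ of $P_2$ and $w\in\widetilde{\Sigma}^*$: if some outgoing letter of $q_1$ is $\prec_w$-smaller than some outgoing letter of $q_2$, then every outgoing letter of $q_1$ is $\prec_w$-smaller than every outgoing letter of $q_2$. *)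

(* Defs.v *)
From mathcomp Require Import all_boot.
From Stdlib Require Import Relation_Operators.

Set Implicit Arguments.
Unset Strict Implicit.
Unset Printing Implicit Defensive.

(* Kinds of letters of a visibly pushdown alphabet. A VP alphabet is a finite
   type [S] together with a kind map [k : S -> vkind]. *)
Inductive vkind := VCall | VRet | VInt.

Record vpa (S : finType) (k : S -> vkind) := VPA {
  vstate : finType;
  vstack : finType;
  vbot : vstack;
  vinit : pred vstate;
  vfinal : pred vstate;
  vcall : vstate -> S -> vstate -> vstack -> bool;
  vret : vstate -> S -> vstack -> vstate -> bool;
  vint : vstate -> S -> vstate -> bool
}.
Arguments vpa {S} k.

Section VPA.
Variables (S : finType) (k : S -> vkind).

Definition isCall (a : S) : bool := if k a is VCall then true else false.
Definition isRet (a : S) : bool := if k a is VRet then true else false.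

(* Visibly pushdown automaton (Q, Q^in, Gamma, delta, Q^F) over (S, k).
   The stack alphabet [vstack] contains the bottom symbol [vbot].
   Call transitions (q, a, q', g) push g (required to be <> bot);
   return transitions (q, a, g, q') pop the top g (reading bot on the empty
   stack); internal transitions (q, a, q') leave the stack unchanged.
   Transitions are only used on letters of the corresponding kind. *)


Variable P : vpa k.

(* reach q s w q' : from configuration (q, s) (s = stack content, top first,
   never containing bot) reading w, some run ends in state q'. *)
Fixpoint reach (q : vstate P) (s : seq (vstack P)) (w : seq S) (q' : vstate P)
  : Prop :=
  match w with
  | [::] => q' = q
  | a :: w' =>
    match k a with
    | VCall => exists q1 g, g != vbot P /\ vcall q a q1 g /\ reach q1 (g :: s) w' q'
    | VRet =>
      match s with
      | [::] => exists q1, vret q a (vbot P) q1 /\ reach q1 [::] w' q'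
      | g :: s' => exists q1, vret q a g q1 /\ reach q1 s' w' q'
      end
    | VInt => exists q1, vint q a q1 /\ reach q1 s w' q'
    end
  end.

Definition reached (w : seq S) (q : vstate P) : Prop :=
  exists q0, vinit q0 /\ reach q0 [::] w q.

Definition lang_of (w : seq S) : Prop :=
  exists q, reached w q /\ vfinal q.

Definition deterministic : Prop :=
  (exists q0 : vstate P, forall q, vinit q <-> q = q0) /\
  (forall q a, isCall a -> forall q1 g1 q2 g2,
      g1 != vbot P -> vcall q a q1 g1 -> g2 != vbot P -> vcall q a q2 g2 ->
      q1 = q2 /\ g1 = g2) /\
  (forall (q : vstate P) a g, isRet a -> forall q1 q2, vret q a g q1 -> vret q a g q2 -> q1 = q2) /\
  (forall (q : vstate P) a, k a = VInt -> forall q1 q2, vint q a q1 -> vint q a q2 -> q1 = q2).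

Definition complete : Prop :=
  (forall (q : vstate P) a, isCall a -> exists q1 g, g != vbot P /\ vcall q a q1 g) /\
  (forall (q : vstate P) a g, isRet a -> exists q1, vret q a g q1) /\
  (forall (q : vstate P) a, k a = VInt -> exists q1, vint q a q1).

Definition outgoing (q : vstate P) (a : S) : Prop :=
  match k a with
  | VCall => exists q1 g, g != vbot P /\ vcall q a q1 g
  | VRet => exists g q1, vret q a g q1
  | VInt => exists q1, vint q a q1
  end.

End VPA.

Section Words.
Variables (S : finType) (k : S -> vkind).

Definition well_matched (w : seq S) : Prop :=
  (forall n, count (isRet k) (take n w) <= count (isCall k) (take n w)) /\
  count (isRet k) w = count (isCall k) w.

Definition strict_total (r : rel S) : Prop :=
  irreflexive r /\ transitive r /\ (forall a b, a != b -> r a b || r b a).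

Definition contextual_order (prec : seq S -> rel S) : Prop :=
  forall w, strict_total (prec w).

Definition ctx_le (prec : seq S -> rel S) (s r : seq S) : Prop :=
  prefix s r \/
  exists al a be b ga, s = al ++ a :: be /\ r = al ++ b :: ga /\ prec al a b.

Definition represents (A : vpa k) (prec : seq S -> rel S) : Prop :=
  complete A /\ deterministic A /\
  exists ord : vstate A -> rel S,
    (forall q, strict_total (ord q)) /\
    (forall w q, reached w q -> prec w =2 ord q).

End Words.

Section Product.
Variables (S1 S2 : finType) (k1 : S1 -> vkind) (k2 : S2 -> vkind).

Definition sumk (x : (S1 + S2)%type) : vkind :=
  match x with inl a => k1 a | inr b => k2 b end.

Definition side (x : (S1 + S2)%type) : bool := if x is inl _ then true else false.

Definition proj1 (w : seq (S1 + S2)) : seq S1 :=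
  pmap (fun x => if x is inl a then Some a else None) w.
Definition proj2 (w : seq (S1 + S2)) : seq S2 :=
  pmap (fun x => if x is inr b then Some b else None) w.

Definition shuffle (L1 : seq S1 -> Prop) (L2 : seq S2 -> Prop)
  (w : seq (S1 + S2)) : Prop := L1 (proj1 w) /\ L2 (proj2 w).

Definition well_nested (w : seq (S1 + S2)) : Prop :=
  forall u c m r v, w = u ++ c :: m ++ r :: v ->
    isCall sumk c -> isRet sumk r -> well_matched sumk m -> side c = side r.

Definition join L1 L2 (w : seq (S1 + S2)) : Prop :=
  shuffle L1 L2 w /\ well_nested w.

Definition indep (a b : S1 + S2) : bool := side a != side b.

Inductive swap1 : seq (S1 + S2) -> seq (S1 + S2) -> Prop :=
  swap1_intro u a b v : indep a b -> swap1 (u ++ a :: b :: v) (u ++ b :: a :: v).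

Definition equivI : seq (S1 + S2) -> seq (S1 + S2) -> Prop :=
  clos_refl_trans (seq (S1 + S2)) swap1.

Definition red (prec : seq (S1 + S2) -> rel (S1 + S2))
  (L : seq (S1 + S2) -> Prop) (w : seq (S1 + S2)) : Prop :=
  L w /\ forall u, L u -> equivI u w -> ctx_le prec u w -> u = w.

Definition uniform (P1 : vpa k1) (P2 : vpa k2)
  (prec : seq (S1 + S2) -> rel (S1 + S2)) : Prop :=
  forall (q1 : vstate P1) (q2 : vstate P2) (w : seq (S1 + S2)),
    (exists a b, outgoing q1 a /\ outgoing q2 b /\ prec w (inl a) (inr b)) ->
    forall a b, outgoing q1 a -> outgoing q2 b -> prec w (inl a) (inr b).

End Product.

(* Main.v *)
(** Let w1 and w2 be well-matched, and read a well-nested shuffle of them letter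
    by letter, recording the stack of the sides of the pending calls.  A
    well-nested prefix can always be completed, so a shuffle w fails to be
    lexicographically minimal exactly when, at some position where it reads x,
    the next letter a of the other component is smaller than x and is enabled:
    a is not a return, or the topmost pending call is on its side.
    By uniformity, whether a is smaller than x depends only on the current
    states of P1, P2 and A.  If it is smaller and the topmost pending call is on
    the side of a, then w is rejected, as a further letter on that side must
    come and is enabled; otherwise w is acceptable exactly when the next letter
    on the side of a, if any, is a return.  One bit per side remembers this
    requirement, and one of three values the side of the topmost pending call,
    whence the factor 12 = 2 * 2 * 3. *)

Require Import Defs.
From mathcomp Require Import all_boot.
From Stdlib Require Import Relation_Operators.

Set Implicit Arguments.
Unset Strict Implicit.
Unset Printing Implicit Defensive.

(** * Well-matchedness by a height counter *)

Section Balanced.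
Variables (S : finType) (k : S -> vkind).

(** [h] counts the calls left open before [w], all to be closed within [w]; this form supports
    induction on the word. *)
Fixpoint balanced (h : nat) (w : seq S) : bool :=
  match w with
  | [::] => h == 0
  | a :: w' => match k a with
               | VCall => balanced h.+1 w'
               | VRet => (0 < h) && balanced h.-1 w'
               | VInt => balanced h w'
               end
  end.

Lemma balancedP h w :
  balanced h w <->
  (forall n, count (isRet k) (take n w) <= h + count (isCall k) (take n w)) /\
  count (isRet k) w = h + count (isCall k) w.
Proof.
elim: w h => [|a w IH] h /=.
  by split=> [/eqP->|[_ /esym/eqP]]; rewrite addn0.
rewrite /isRet /isCall; case Ek: (k a).
- apply: (iff_trans (IH _)); split=> -[H1 H2]; split.
  + by case=> [|n] //=; rewrite Ek addnA addn1 H1.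
  + by rewrite H2 addSn add0n addnS.
  + by move=> n; move: (H1 n.+1); rewrite /= Ek addnA addn1.
  + by move: H2; rewrite !add0n addnA addn1.
- split.
  + case/andP; case: h => // h _ /IH [H1 H2]; split; last by rewrite add1n H2.
    by case=> [|n] //=; rewrite Ek add1n ltnS H1.
  + case=> H1 H2; case: h H1 H2 => [|h] H1 H2.
      by move: (H1 1); rewrite /= take0 /= Ek.
    apply/IH; split; last by move: H2; rewrite !add0n add1n addSn => -[].
    by move=> n; move: (H1 n.+1); rewrite /= Ek add1n add0n addSn ltnS.
- apply: (iff_trans (IH _)); split=> -[H1 H2]; split=> //.
  + by case=> [|n] //=; rewrite Ek H1.
  + by move=> n; move: (H1 n.+1); rewrite /= Ek.
Qed.

Lemma well_matchedP w : well_matched k w <-> balanced 0 w.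
Proof. exact: iff_sym (balancedP 0 w). Qed.

Lemma balanced_cat h1 h2 w1 w2 :
  balanced h1 w1 -> balanced h2 w2 -> balanced (h1 + h2) (w1 ++ w2).
Proof.
elim: w1 h1 => [|a w IH] h /=; first by move/eqP->.
case: (k a) => [/IH H /H //||]; last exact: IH.
by case: h => // h /= /IH.
Qed.

End Balanced.

(** * Well-nestedness by a stack of sides *)

Section Nesting.
Variables (S1 S2 : finType) (k1 : S1 -> vkind) (k2 : S2 -> vkind).
Let k := sumk k1 k2.
Implicit Types (st : seq bool).

Definition side_step st (x : S1 + S2) : seq bool :=
  match k x with
  | VCall => side x :: st
  | VRet => behead st
  | VInt => st
  end.

Definition enabled st (x : S1 + S2) : bool :=
  isRet k x ==> (ohead st == Some (side x)).

(** [st] lists the sides of the pending calls, top first. The final test makes [nested [::]] cover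
    well-matchedness besides well-nestedness. *)
Fixpoint nested st w : bool :=
  if w is x :: w' then enabled st x && nested (side_step st x) w' else st == [::].

Lemma balanced_proj h1 h2 w :
  balanced k1 h1 (proj1 w) -> balanced k2 h2 (proj2 w) ->
  balanced k (h1 + h2) w.
Proof.
elim: w h1 h2 => [|[a|a] w IH] h1 h2 /=; first by move=> /eqP-> /eqP->.
- case: (k1 a) => [|/andP[]|] H1.
  + by move/(IH _ _ H1).
  + by case: h1 H1 => // h1 _ H /(IH _ _ H).
  + by move/(IH _ _ H1).
- move=> H1; case: (k2 a) => [|/andP[]|].
  + by move/(IH _ _ H1); rewrite addnS.
  + by case: h2 => // h2 _ /(IH _ _ H1); rewrite addnS.
  + by move/(IH _ _ H1).
Qed.

Lemma balanced_inl st a w1 : enabled st (inl a) ->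
  balanced k1 (count id st) (a :: w1) =
    balanced k1 (count id (side_step st (inl a))) w1 /\
  count negb (side_step st (inl a)) = count negb st.
Proof.
rewrite /enabled /isRet /side_step /=; case: (k1 a) => //=.
by case: st => [|[] st].
Qed.

Lemma balanced_inr st a w2 : enabled st (inr a) ->
  balanced k2 (count negb st) (a :: w2) =
    balanced k2 (count negb (side_step st (inr a))) w2 /\
  count id (side_step st (inr a)) = count id st.
Proof.
rewrite /enabled /isRet /side_step /=; case: (k2 a) => //=.
by case: st => [|[] st].
Qed.

Lemma nested_proj st w : nested st w ->
  balanced k1 (count id st) (proj1 w) /\ balanced k2 (count negb st) (proj2 w).
Proof.
elim: w st => [|[a|a] w IH] st; first by move/eqP->.
- by case/andP=> /(balanced_inl (proj1 w))[-> <-] /IH.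
- by case/andP=> /(balanced_inr (proj2 w))[-> <-] /IH.
Qed.

Lemma nested_catr u st w : nested st (u ++ w) -> exists st', nested st' w.
Proof.
elim: u st => [|x u IH] st /=; first by exists st.
by case/andP=> _ /IH.
Qed.

Lemma nested_skip t st m w :
  balanced k (size t) m -> nested (t ++ st) (m ++ w) -> nested st w.
Proof.
elim: m t => [|x m IH] t /=; first by move/nilP->.
rewrite /side_step; case: (k x) => B /andP[_].
- exact: (IH (side x :: t)).
- by case: t B => // b t /=; apply: IH.
- exact: IH.
Qed.

(** The side of [c] is on top after [c] and again after the well-matched [m], so [enabled] at [r]
    compares the two sides. *)
Lemma nested_well_nested st w : nested st w -> well_nested k1 k2 w.
Proof.
move=> N u c m r v E Cc Rr /well_matchedP Bm.
move: N; rewrite E => /nested_catr [st'] /= /andP[_].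
have -> : side_step st' c = [:: side c] ++ st'.
  by rewrite /side_step /k; move: Cc; rewrite /isCall; case: (sumk _ _ c).
move/(@nested_skip [::] ([:: side c] ++ st') m _ Bm) => /= /andP[].
by rewrite /enabled Rr /= => /eqP[].
Qed.

(* [frames p st]: [p = m_n c_n ... m_1 c_1 m_0] where the [m_i] are
   well-matched and the pending calls [c_i] have their sides listed by [st],
   top first. *)
Inductive frames : seq (S1 + S2) -> seq bool -> Prop :=
| frames_nil m : balanced k 0 m -> frames m [::]
| frames_cons p st c m : frames p st -> isCall k c -> balanced k 0 m ->
    frames (p ++ c :: m) (side c :: st).

Lemma frames_cat p st m : frames p st -> balanced k 0 m -> frames (p ++ m) st.
Proof.
case=> [m' B' B|p' st' c m' F C B' B].
  by apply: frames_nil; apply: (balanced_cat B').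
by rewrite -catA /=; apply: frames_cons => //; apply: (balanced_cat B').
Qed.

(** The frames of the prefix already read exhibit, for each return, its matching call and the
    well-matched word in between, to which [well_nested] applies. *)
Lemma well_nested_frames p st w :
  frames p st -> balanced k (size st) w -> well_nested k1 k2 (p ++ w) ->
  nested st w.
Proof.
elim: w p st => [|x w IH] p st F /=; first by move/nilP->.
rewrite -cat_rcons -cats1 /enabled /side_step /isRet.
case Ex: (k x) => B W /=.
- apply: (IH (p ++ [:: x])) => //; apply: frames_cons => //.
  by rewrite /isCall Ex.
- case: F B W => // {}p {}st c m F C Bm /= B W.
  have Es : side c = side x.
    apply: (W p c m x w) => //; last exact/well_matchedP.
      by rewrite -!catA.
    by rewrite /isRet -/k Ex.
  rewrite Es eqxx /=.
  apply: (IH ((p ++ c :: m) ++ [:: x])) => //.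
  rewrite -catA; apply: frames_cat => //=.
  move: C; rewrite /isCall; case: (k c) => // _.
  by apply: (balanced_cat (h1 := 0) Bm) => /=; rewrite Ex.
- apply: (IH (p ++ [:: x])) => //; apply: frames_cat => //=.
  by rewrite Ex.
Qed.

Lemma well_nestedP w : balanced k1 0 (proj1 w) -> balanced k2 0 (proj2 w) ->
  well_nested k1 k2 w <-> nested [::] w.
Proof.
move=> B1 B2; split; last exact: nested_well_nested.
apply: (@well_nested_frames [::]); first exact: frames_nil.
exact: (balanced_proj B1 B2).
Qed.

(* Always advancing the component that owns the topmost pending call never
   gets stuck. *)
Lemma nested_completion st w1 w2 :
  balanced k1 (count id st) w1 -> balanced k2 (count negb st) w2 ->
  exists v, [/\ proj1 v = w1, proj2 v = w2 & nested st v].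
Proof.
have [n] := ubnP (size w1 + size w2).
elim: n st w1 w2 => // n IH st w1 w2 Hn B1 B2.
have left a w : w1 = a :: w -> enabled st (inl a) ->
    exists v, [/\ proj1 v = w1, proj2 v = w2 & nested st v].
  move=> E En; have [E1 E2] := balanced_inl w En.
  have [|||v [V1 V2 V3]] := IH (side_step st (inl a)) w w2.
  - by move: Hn; rewrite E.
  - by rewrite -E1 -E.
  - by rewrite E2.
  by exists (inl a :: v); rewrite /= V1 V2 En E.
have right a w : w2 = a :: w -> enabled st (inr a) ->
    exists v, [/\ proj1 v = w1, proj2 v = w2 & nested st v].
  move=> E En; have [E1 E2] := balanced_inr w En.
  have [|||v [V1 V2 V3]] := IH (side_step st (inr a)) w1 w.
  - by move: Hn; rewrite E /= addnS.
  - by rewrite E2.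
  - by rewrite -E1 -E.
  by exists (inr a :: v); rewrite /= V1 V2 En E.
case: st B1 B2 left right {IH Hn} => [|[] st]; rewrite /enabled /isRet.
(* With no pending call, height 0 rules out a return as first letter, so any nonempty component can
   move. *)
- case: w1 => [|a w1] B1; last first.
    by move=> _ /(_ a w1 erefl) + _; apply; move: B1 => /=; case: (k1 a).
  case: w2 => [|a w2] B2 _; first by exists [::].
  by move=> /(_ a w2 erefl); apply; move: B2 => /=; case: (k2 a).
(* A pending left call forces the left word to be nonempty, and its first letter is enabled whatever
   its kind. *)
- case: w1 => // a w1 _ _ /(_ a w1 erefl) + _; apply; exact: implybT.
- case: w2 => // a w2 _ _ _ /(_ a w2 erefl); apply; exact: implybT.
Qed.

End Nesting.

(** * Lexicographically minimal nested shuffles *)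

Section Minimal.
Variables (S1 S2 : finType) (k1 : S1 -> vkind) (k2 : S2 -> vkind).
Local Notation S := (S1 + S2)%type.
Implicit Types (m p u v w : seq S) (st : seq bool).

Lemma proj_cat (u v : seq S) :
  proj1 (u ++ v) = proj1 u ++ proj1 v /\ proj2 (u ++ v) = proj2 u ++ proj2 v.
Proof. by rewrite /proj1 /proj2 !pmap_cat. Qed.

Lemma size_proj (w : seq S) : size w = size (proj1 w) + size (proj2 w).
Proof. by elim: w => [|[a|a] w IH] //=; rewrite IH ?addnS. Qed.

Definition same_proj (u w : seq S) := proj1 u = proj1 w /\ proj2 u = proj2 w.

Lemma equivI_proj u w : equivI u w -> same_proj u w.
Proof.
elim=> [_ _ [x a b y ab]|//|x y z _ [H1 H2] _ [H3 H4]].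
- rewrite /same_proj !(proj_cat x _).1 !(proj_cat x _).2.
  by case: a b ab => a [].
- by split; [rewrite H1|rewrite H2].
Qed.

Lemma equivI_cat p u w : equivI u w -> equivI (p ++ u) (p ++ w).
Proof.
elim=> [_ _ [x a b y ab]|x|x y z _ H1 _ H2].
- by apply: rt_step; rewrite !(catA p); apply: swap1_intro.
- exact: rt_refl.
- exact: rt_trans H1 H2.
Qed.

Lemma equivI_front m x v : all (indep x) m -> equivI (m ++ x :: v) (x :: m ++ v).
Proof.
elim: m => [|y m IH] /=; first by move=> _; apply: rt_refl.
case/andP=> xy /IH /(equivI_cat [:: y]) H; apply: rt_trans H _.
by apply: rt_step; apply: (@swap1_intro _ _ [::]); rewrite /indep eq_sym.
Qed.

Lemma proj1_cons u a l : proj1 u = a :: l ->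
  exists m v, u = m ++ inl a :: v /\ all (indep (inl a : S)) m.
Proof.
elim: u => [|[b|b] u IH] //=; first by case=> -> _; exists [::], u.
by move=> /IH [m [v [-> H]]]; exists (inr b :: m), v.
Qed.

Lemma proj2_cons u a l : proj2 u = a :: l ->
  exists m v, u = m ++ inr a :: v /\ all (indep (inr a : S)) m.
Proof.
elim: u => [|[b|b] u IH] //=; last by case=> -> _; exists [::], u.
by move=> /IH [m [v [-> H]]]; exists (inl b :: m), v.
Qed.

Lemma same_proj_cons x u w : same_proj (x :: u) (x :: w) <-> same_proj u w.
Proof.
rewrite /same_proj; case: x => a /=; split=> -[].
- by case=> -> ->.
- by move=> -> ->.
- by move=> -> [->].
- by move=> -> ->.
Qed.

(** The first letter of [w] is preceded in [u] only by letters of the other side; commute it to the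
    front and continue with the rest. *)
Lemma proj_equivI u w : same_proj u w -> equivI u w.
Proof.
elim: w u => [|x w IH] u uw.
  have : size u = 0 by rewrite size_proj uw.1 uw.2.
  by move/size0nil->; apply: rt_refl.
have [m [v [Eu im]]] : exists m v, u = m ++ x :: v /\ all (indep x) m.
  case: x uw => a /= [H1 H2]; [exact: proj1_cons H1|exact: proj2_cons H2].
have /equivI_front H := im; rewrite Eu; apply: rt_trans (H v) _.
apply: (equivI_cat [:: x]); apply: IH; apply/(same_proj_cons x).
have [K1 K2] := equivI_proj (H v).
by case: uw; rewrite Eu K1 K2.
Qed.

Definition next (d : bool) (w : seq S) : option S :=
  if d then omap inl (ohead (proj1 w)) else omap inr (ohead (proj2 w)).

Lemma next_side d w a : next d w = Some a -> side a = d.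
Proof.
by case: d => /=; [case: (proj1 w)|case: (proj2 w)] => // b l [<-].
Qed.

Lemma next_cons d x w : next d (x :: w) = if side x == d then Some x else next d w.
Proof. by case: x d => a []. Qed.

(** The order seen after reading [x]; inductions on words can then always compare in the empty
    context. *)
Definition shift (prec : seq S -> rel S) (x : S) : seq S -> rel S :=
  fun v => prec (x :: v).

Lemma ctx_le_cons prec x u w : contextual_order prec ->
  ctx_le prec (x :: u) (x :: w) <-> ctx_le (shift prec x) u w.
Proof.
move=> Co; rewrite /ctx_le /= eqxx; split=> -[le|]; try by [left].
- move=> [[|y al] [a [be [b [ga [[<- ->] [[]]]]]]]].
    by move=> <- _; rewrite (Co [::]).1.
  by move=> -> H; right; exists al, a, be, b, ga.
- case=> al [a [be [b [ga [-> [-> H]]]]]]; right.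
  by exists (x :: al), a, be, b, ga.
Qed.

Lemma ctx_le_neq prec x y u w : y != x ->
  ctx_le prec (y :: u) (x :: w) <-> prec [::] y x.
Proof.
move=> yx; split; last by move=> H; right; exists [::], y, u, x, w.
case=> [/=|[[|z al] [a [be [b [ga]]]]]]; first by rewrite (negbTE yx).
  by case=> -[-> _] [[-> _]].
by case=> -[Ey _] [[Ex _]]; rewrite Ey Ex eqxx in yx.
Qed.

(** An enabled return pops a call on its own side, so only a letter of side [d] can remove an entry
    [d], and the stack must end empty. *)
Lemma nested_next st w d : nested k1 k2 st w -> d \in st ->
  exists a, next d w = Some a.
Proof.
elim: w st => [|x w IH] st /=; first by move/eqP->.
rewrite next_cons /enabled /side_step /isRet => /andP[En N] dst.
case: eqP => [_|xd]; first by exists x.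
apply: IH N _; move: En; case: (sumk k1 k2 x) => //=.
  by rewrite inE dst orbT.
case: st dst => // b st; rewrite inE => /orP[/eqP db|//] /eqP[bx].
by case: xd; rewrite db bx.
Qed.

Fixpoint greedy (prec : seq S -> rel S) (st : seq bool) (w : seq S) : Prop :=
  if w is x :: w' then
    (forall a, next (~~ side x) w' = Some a -> prec [::] a x ->
       ~~ enabled k1 k2 st a) /\
    greedy (shift prec x) (side_step k1 k2 st x) w'
  else True.

Lemma next_split st d w a : next d w = Some a -> nested k1 k2 st w ->
  enabled k1 k2 st a ->
  exists v, same_proj (a :: v) w /\ nested k1 k2 st (a :: v).
Proof.
move=> + /nested_proj [B1 B2]; rewrite /next /same_proj.
case: d; [case E: (proj1 w) B1 => [|b l] //|case E: (proj2 w) B2 => [|b l] //].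
- move=> + [<-] En; have [-> C2] := balanced_inl l En; rewrite -C2 in B2.
  move=> /nested_completion /(_ B2) [v [V1 V2 V3]].
  by exists v; rewrite /= V1 V2 En V3.
- move=> + [<-] En; have [-> C1] := balanced_inr l En; rewrite -C1 in B1.
  move=> /(nested_completion B1) [v [V1 V2 V3]].
  by exists v; rewrite /= V1 V2 En V3.
Qed.

(** Compare at the first difference: a smaller shuffle must read there the next letter of the other
    side. Conversely, a smaller enabled letter extends to a complete smaller shuffle by
    [next_split]. *)
Lemma greedyP prec st w : contextual_order prec -> nested k1 k2 st w ->
  greedy prec st w <->
  (forall u, same_proj u w -> nested k1 k2 st u -> ctx_le prec u w -> u = w).
Proof.
elim: w prec st => [|x w IH] prec st Co /=.
  move=> _; split=> // _ u [U1 U2] _ _; apply: size0nil.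
  by rewrite size_proj U1 U2.
case/andP=> En Nw; have Co' : contextual_order (shift prec x) by move=> v; apply: Co.
have {}IH := IH _ _ Co' Nw; split=> [[G1 /IH G2]|G].
- case=> [|y u] uw; first by have := size_proj (x :: w); rewrite -uw.1 -uw.2.
  have [E|yx] := eqVneq y x.
    move: uw; rewrite {y}E => uw /= /andP[_ Nu] /(ctx_le_cons _ _ _ Co) le; congr (_ :: _).
    by apply: G2 => //; apply/(same_proj_cons x).
  move=> /= /andP[Ey _] /(ctx_le_neq _ _ _ yx) lt.
  have Ny : next (~~ side x) w = Some y.
    case: x y uw yx {G1 G2 IH En Nw Co' Ey lt} => a [] b [] /=.
    + by case=> ->; rewrite eqxx.
    + by rewrite /next => _ <-.
    + by rewrite /next => <-.
    + by move=> _ [->]; rewrite eqxx.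
  by have := G1 _ Ny lt; rewrite Ey.
- split.
  + move=> a Na lt; apply/negP => Ea.
    have Na' : next (~~ side x) (x :: w) = Some a.
      by rewrite next_cons Na; case: (side x).
    have Nxw : nested k1 k2 st (x :: w) by rewrite /= En.
    have [v [vw Nv]] := next_split Na' Nxw Ea.
    have ax : a != x.
      by apply/eqP => E; have := next_side Na; rewrite E; case: (side x).
    have [E] := G _ vw Nv ((ctx_le_neq _ _ _ ax).2 lt).
    by rewrite E eqxx in ax.
  + apply/IH => u uw Nu le.
    suff: x :: u = x :: w by case.
    apply: G.
    * exact/same_proj_cons.
    * by rewrite /= En.
    * exact/ctx_le_cons.
Qed.

Lemma redP prec (L1 : seq S1 -> Prop) (L2 : seq S2 -> Prop) w :
  contextual_order prec ->
  (forall l, L1 l -> well_matched k1 l) ->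
  (forall l, L2 l -> well_matched k2 l) ->
  red prec (join k1 k2 L1 L2) w <->
  [/\ L1 (proj1 w), L2 (proj2 w), nested k1 k2 [::] w & greedy prec [::] w].
Proof.
move=> Co W1 W2.
have nestP u : L1 (proj1 u) -> L2 (proj2 u) ->
    well_nested k1 k2 u <-> nested k1 k2 [::] u.
  by move=> /W1 /well_matchedP B1 /W2 /well_matchedP B2; apply: well_nestedP.
split=> [[[[l1 l2] /(nestP _ l1 l2) Nw] min]|[l1 l2 Nw /(greedyP Co Nw) G]].
- split=> //; apply/(greedyP Co Nw) => u uw Nu le; apply: min => //.
    have [u1 u2] := uw; split; first by split; rewrite (u1, u2).
    exact: nested_well_nested Nu.
  exact: proj_equivI.
- split; first by split=> //; apply/nestP.
  move=> u [[u1 u2] /(nestP _ u1 u2) Nu] /equivI_proj uw; exact: G.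
Qed.

End Minimal.

(** * Runs decomposed into single steps *)

Section Steps.
Variables (S : finType) (k : S -> vkind) (P : vpa k).

(** The default of [head] makes a return on the empty stack read [vbot], merging the two return
    cases of [reach]. *)
Definition step (q : vstate P) (s : seq (vstack P)) a q' s' : Prop :=
  match k a with
  | VCall => exists g, [/\ g != vbot P, vcall q a q' g & s' = g :: s]
  | VRet => vret q a (head (vbot P) s) q' /\ s' = behead s
  | VInt => vint q a q' /\ s' = s
  end.

Lemma reach_cons q s a w q' : reach q s (a :: w) q' <->
  exists q1 s1, step q s a q1 s1 /\ reach q1 s1 w q'.
Proof.
rewrite /step /=; case: (k a).
- split=> [[q1 [g [gb [c r]]]]|[q1 [_ [[g [gb c ->]] r]]]].
    by exists q1, (g :: s); split=> //; exists g.
  by exists q1, g.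
- case: s => [|g s]; split=> [[q1 [c r]]|[q1 [_ [[c ->] r]]]]; try by exists q1.
    by exists q1, [::].
  by exists q1, s.
- split=> [[q1 [c r]]|[q1 [_ [[c ->] r]]]]; last by exists q1.
  by exists q1, s.
Qed.

Definition accepts_from (q : vstate P) s w := exists q', reach q s w q' /\ vfinal q'.

Lemma accepts_cons q s a w : accepts_from q s (a :: w) <->
  exists q1 s1, step q s a q1 s1 /\ accepts_from q1 s1 w.
Proof.
split=> [[q' [/reach_cons [q1 [s1 [st r]]] f]]|[q1 [s1 [st [q' [r f]]]]]].
  by exists q1, s1; split=> //; exists q'.
by exists q'; split=> //; apply/reach_cons; exists q1, s1.
Qed.

Lemma lang_of_accepts w :
  lang_of P w <-> exists q0 : vstate P, vinit q0 /\ accepts_from q0 [::] w.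
Proof.
split=> [[q [[q0 [i r]] f]]|[q0 [i [q [r f]]]]].
  by exists q0; split=> //; exists q.
by exists q; split=> //; exists q0.
Qed.

Lemma complete_step q s a : complete P -> exists q' s', step q s a q' s'.
Proof.
case=> C [R I]; rewrite /step; case Ea: (k a).
- have [|q' [g [gb c]]] := C q a; first by rewrite /isCall Ea.
  by exists q', (g :: s), g.
- have [|q' c] := R q a (head (vbot P) s); first by rewrite /isRet Ea.
  by exists q', (behead s).
- by have [q' c] := I q a Ea; exists q', s.
Qed.

Definition outgoingb (q : vstate P) (a : S) : bool :=
  match k a with
  | VCall => [exists q1, exists g, (g != vbot P) && vcall q a q1 g]
  | VRet => [exists g, exists q1, vret q a g q1]
  | VInt => [exists q1, vint q a q1]
  end.

Lemma outgoingP q a : reflect (outgoing q a) (outgoingb q a).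
Proof.
apply: (iffP idP); rewrite /outgoing /outgoingb; case: (k a).
- by move=> /existsP[q1 /existsP[g /andP[gb c]]]; exists q1, g.
- by move=> /existsP[g /existsP[q1 c]]; exists g, q1.
- by move=> /existsP[q1 c]; exists q1.
- move=> [q1 [g [gb c]]].
  by apply/existsP; exists q1; apply/existsP; exists g; rewrite gb.
- by move=> [g [q1 c]]; apply/existsP; exists g; apply/existsP; exists q1.
- by move=> [q1 c]; apply/existsP; exists q1.
Qed.

Lemma step_outgoing q s a q' s' : step q s a q' s' -> outgoing q a.
Proof.
rewrite /step /outgoing; case: (k a).
- by case=> g [gb c _]; exists q', g.
- by case=> c _; exists (head (vbot P) s), q'.
- by case=> c _; exists q'.
Qed.

Lemma accepts_outgoing q s a w : accepts_from q s (a :: w) -> outgoing q a.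
Proof. by case/accepts_cons=> q1 [s1 [/step_outgoing]]. Qed.

End Steps.

(** * The product automaton and its correctness *)

Section Product.
Variables (S1 S2 : finType) (k1 : S1 -> vkind) (k2 : S2 -> vkind).
Variables (P1 : vpa k1) (P2 : vpa k2) (A : vpa (sumk k1 k2)).
Variable ord : vstate A -> rel (S1 + S2).
Local Notation S := (S1 + S2)%type.
Local Notation k := (sumk k1 k2).

(* Side of the topmost pending call, and for each side (left first) whether
   its next letter has to be a return. *)
Definition control : Type := option bool * (bool * bool).
Definition top (c : control) := c.1.
Definition must_return (c : control) (d : bool) := if d then c.2.1 else c.2.2.

(* Under uniformity, any outgoing letter of the other component stands for the
   one that is actually read next. *)
Definition postponing q1 q2 qA (x : S) : bool :=
  match x with
  | inl b => [exists a, outgoingb (P := P2) q2 a && ord qA (inr a) (inl b)]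
  | inr b => [exists a, outgoingb (P := P1) q1 a && ord qA (inl a) (inr b)]
  end.

(* When the other side owns the topmost pending call, its next letter, which
   exists, could be read now; otherwise only a return could not. *)
Definition control_ok (p : bool) (x : S) (c c' : control) : bool :=
  [&& must_return c (side x) ==> isRet k x,
      p ==> (top c != Some (~~ side x)),
      ~~ must_return c' (side x) &
      must_return c' (~~ side x) == must_return c (~~ side x) || p].

Definition pstate : finType :=
  (vstate P1 * vstate P2 * vstate A * (option bool * (bool * bool)))%type.
(** The bottom symbol is added later as [None]; no transition pops it, so a return with no pending
    call blocks the run. *)
Definition psym : finType := ((vstack P1 + vstack P2) * vstack A * option bool)%type.

Definition component_call q1 q2 (x : S) q1' q2' (g : vstack P1 + vstack P2) :=
  match x, g with
  | inl a, inl g1 => [&& g1 != vbot P1, vcall q1 a q1' g1 & q2' == q2]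
  | inr a, inr g2 => [&& g2 != vbot P2, vcall q2 a q2' g2 & q1' == q1]
  | _, _ => false
  end.

(* A stack symbol records the pushed symbols of [P1] or [P2] and of [A], and
   the side of the pending call below. *)
Definition prod_vpa : vpa k := {|
  vstate := pstate;
  vstack := option psym;
  vbot := None;
  vinit := fun p => let: (q1, q2, qA, c) := p in
    [&& vinit q1, vinit q2, vinit qA & c == (None, (false, false))];
  vfinal := fun p => let: (q1, q2, qA, c) := p in
    [&& vfinal q1, vfinal q2 & top c == None];
  vcall := fun p x p' y =>
    let: (q1, q2, qA, c) := p in let: (q1', q2', qA', c') := p' in
    if y is Some (g, gA, t) then
      [&& gA != vbot A, vcall qA x qA' gA, t == top c, top c' == Some (side x),
          control_ok (postponing q1 q2 qA x) x c c' &
          component_call q1 q2 x q1' q2' g]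
    else false;
  vret := fun p x y p' =>
    let: (q1, q2, qA, c) := p in let: (q1', q2', qA', c') := p' in
    if y is Some (g, gA, t) then
      [&& vret qA x gA qA', top c' == t, control_ok (postponing q1 q2 qA x) x c c' &
          match x, g with
          | inl a, inl g1 => vret q1 a g1 q1' && (q2' == q2)
          | inr a, inr g2 => vret q2 a g2 q2' && (q1' == q1)
          | _, _ => false
          end]
    else false;
  vint := fun p x p' =>
    let: (q1, q2, qA, c) := p in let: (q1', q2', qA', c') := p' in
    [&& vint qA x qA', top c' == top c, control_ok (postponing q1 q2 qA x) x c c' &
        match x with
        | inl a => vint q1 a q1' && (q2' == q2)
        | inr a => vint q2 a q2' && (q1' == q1)
        end]
|}.

(** A product stack is a shuffle of the two component stacks, so the projections of words split it
    too. *)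
Definition stack1 (s : seq psym) := proj1 [seq y.1.1 | y <- s].
Definition stack2 (s : seq psym) := proj2 [seq y.1.1 | y <- s].
Definition stackA (s : seq psym) := [seq y.1.2 | y <- s].
Definition sides (s : seq psym) := [seq side y.1.1 | y <- s].

(** Each symbol stores the side of the call below it, so popping restores the side of the topmost
    pending call. *)
Fixpoint stack_ok (t : option bool) (s : seq psym) : Prop :=
  t = ohead (sides s) /\ if s is y :: s' then stack_ok y.2 s' else True.

Lemma stack_ok_top t s : stack_ok t s -> t = ohead (sides s).
Proof. by case: s => [|y s] []. Qed.

Lemma prod_step_inv q1 q2 qA c s x q1' q2' qA' c' sB :
  stack_ok (top c) s ->
  step (P := prod_vpa) (q1, q2, qA, c) (map Some s) x (q1', q2', qA', c') sB ->
  exists s', [/\ sB = map Some s', stack_ok (top c') s',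
    enabled k1 k2 (sides s) x /\ sides s' = side_step k1 k2 (sides s) x,
    step (P := A) qA (stackA s) x qA' (stackA s') /\
    match x with
    | inl a => [/\ step (P := P1) q1 (stack1 s) a q1' (stack1 s'),
                   q2' = q2 & stack2 s' = stack2 s]
    | inr a => [/\ step (P := P2) q2 (stack2 s) a q2' (stack2 s'),
                   q1' = q1 & stack1 s' = stack1 s]
    end &
    control_ok (postponing q1 q2 qA x) x c c'].
Proof.
move=> ok; rewrite /enabled /side_step /isRet /step.
case Ex: (k x).
- case=> -[[[g gA] t]|] [] // _ /= /and5P[bA cA /eqP Et /eqP Et' /andP[ck]].
  move=> comp ->; exists ((g, gA, t) :: s); split=> //.
  + split; last by rewrite Et.
    by rewrite Et' /=; case: x {Ex cA Et' ck} g comp => a [].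
  + by split=> //=; case: x {Ex cA Et' ck} g comp => a [].
  + split; first by exists gA.
    case: x {cA Et' ck} g comp Ex => a [] g //= /and3P[b c1 /eqP->] Ex;
      split=> //; rewrite /step Ex; by exists g.
- case: s ok => [|[[g gA] t] s] ok [] // /=.
  move=> /and4P[cA /eqP Et' ck comp] ->; exists s; split=> //.
  + by rewrite Et'; case: ok.
  + by split=> //; case: x {Ex cA ck} g comp ok => a [].
  + split=> //.
    by case: x {cA ck} g comp ok Ex => a [] g //= /andP[c1 /eqP->] _ Ex;
      split=> //; rewrite /step Ex.
- case=> /= /and4P[cA /eqP Et' ck comp] ->; exists s; split=> //.
  + by rewrite Et'.
  + split=> //.
    by case: x {cA ck} comp Ex => a /= /andP[c1 /eqP->] Ex;
      split=> //; rewrite /step Ex.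
Qed.

(** For a return, [enabled] makes the top symbol belong to the component that reads, so the separate
    steps combine. *)
Lemma prod_step_intro q1 q2 qA c s x q1' q2' qA' c' s1' s2' sA' :
  stack_ok (top c) s -> enabled k1 k2 (sides s) x ->
  step (P := A) qA (stackA s) x qA' sA' ->
  match x with
  | inl a => [/\ step (P := P1) q1 (stack1 s) a q1' s1',
                 q2' = q2 & s2' = stack2 s]
  | inr a => [/\ step (P := P2) q2 (stack2 s) a q2' s2',
                 q1' = q1 & s1' = stack1 s]
  end ->
  control_ok (postponing q1 q2 qA x) x c c' ->
  top c' = ohead (side_step k1 k2 (sides s) x) ->
  exists s', [/\
    step (P := prod_vpa) (q1, q2, qA, c) (map Some s) x
         (q1', q2', qA', c') (map Some s'),
    stack_ok (top c') s', sides s' = side_step k1 k2 (sides s) x,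
    stackA s' = sA' & (stack1 s' = s1' /\ stack2 s' = s2')].
Proof.
move=> ok; rewrite /enabled /side_step /isRet /step.
case Ex: (k x) => /=.
- move=> _ [gA [bA cA ->]] comp ck Et'.
  have [g [sg cg]] : exists g : vstack P1 + vstack P2, side g = side x /\
    [/\ component_call q1 q2 x q1' q2' g, stack1 ((g, gA, top c) :: s) = s1' & stack2 ((g, gA, top c) :: s) = s2'].
    case: x Ex comp {cA ck Et'} => a /= Ex [];
      rewrite /step Ex => -[g [b c1 ->]] -> ->.
      by exists (inl g); rewrite b c1 eqxx.
    by exists (inr g); rewrite b c1 eqxx.
  case: cg => cg cg1 cg2; exists ((g, gA, top c) :: s); split=> //=.
  + exists (Some (g, gA, top c)); split=> //=.
    by rewrite bA cA eqxx Et' eqxx ck.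
  + by split=> //; rewrite Et' sg.
  + by rewrite sg.
- case: s ok => [|[[g gA] t] s] //= [Et ok] Eg [cA ->] comp ck Et'.
  exists s; split=> //.
  + split=> //; rewrite cA ck Et' (stack_ok_top ok) eqxx /=.
    case: x Ex comp Eg {cA ck Et' Et} => a /= Ex []; rewrite /step Ex => -[c1 _] -> _;
      by case: g c1 => g //= -> _; rewrite eqxx.
  + by rewrite Et' -(stack_ok_top ok).
  + case: x Ex comp Eg {cA ck Et' Et} => a /= Ex []; rewrite /step Ex => -[_ ->] _ ->;
      by case: g.
- move=> _ [cA ->] comp ck Et'; exists s; split=> //.
  + split=> //; rewrite cA ck Et' (stack_ok_top ok) eqxx /=.
    case: x Ex comp {cA ck Et'} => a /= Ex []; rewrite /step Ex => -[-> _] -> _;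
      by rewrite eqxx.
  + by rewrite Et' -(stack_ok_top ok).
  + by case: x Ex comp {cA ck Et'} => a /= Ex []; rewrite /step Ex => -[_ ->] _ ->.
Qed.

(** The accepting runs read [x] and [a] next, so both are outgoing, and by uniformity any outgoing
    letter of the other component can stand for [a]. *)
Lemma postponing_next prec q1 q2 qA s1 s2 x w a :
  contextual_order prec -> uniform P1 P2 prec -> prec [::] =2 ord qA ->
  accepts_from (P := P1) q1 s1 (proj1 (x :: w)) ->
  accepts_from (P := P2) q2 s2 (proj2 (x :: w)) ->
  next (~~ side x) w = Some a ->
  postponing q1 q2 qA x = prec [::] a x.
Proof.
move=> Co U pq; have [irr [tr tot]] := Co [::].
have asym y z : prec [::] y z -> ~~ prec [::] z y.
  by move=> yz; apply/negP => /(tr _ _ _ yz); rewrite irr.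
rewrite /next; case: x => b /=.
- move=> /accepts_outgoing ob; case: (proj2 w) => // a' l /accepts_outgoing oa.
  case=> <-; apply/existsP/idP => [[a0 /andP[/outgoingP oa0]]|lt].
    (* [uniform] takes the smaller letter from [P1]; here it comes from [P2], so totality and
       asymmetry are used to refute the opposite order. *)
    rewrite -pq => lt; have /orP[//|gt] := tot (inr a') (inl b) isT.
    have := U q1 q2 [::] (ex_intro _ b (ex_intro _ a' (conj ob (conj oa gt)))).
    by move=> /(_ b a0 ob oa0) /asym; rewrite lt.
  by exists a'; rewrite -pq lt andbT; apply/outgoingP.
- case: (proj1 w) => // a' l /accepts_outgoing oa /accepts_outgoing ob.
  case=> <-; apply/existsP/idP => [[a0 /andP[/outgoingP oa0]]|lt].
    rewrite -pq => lt.
    by apply: (U q1 q2 [::]) => //; exists a0, b.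
  by exists a'; rewrite -pq lt andbT; apply/outgoingP.
Qed.

(** The flags of [c] are promises: the next letter of a flagged side, if any, must be a return.
    Generalizing over [prec] lets the induction pass to [shift prec x]. *)
Lemma prod_accepts prec q1 q2 qA c s w :
  complete A -> contextual_order prec -> uniform P1 P2 prec ->
  (forall v q, reach (P := A) qA (stackA s) v q -> prec v =2 ord q) ->
  stack_ok (top c) s ->
  accepts_from (P := prod_vpa) (q1, q2, qA, c) (map Some s) w <->
  [/\ accepts_from (P := P1) q1 (stack1 s) (proj1 w),
      accepts_from (P := P2) q2 (stack2 s) (proj2 w),
      nested k1 k2 (sides s) w,
      forall d a, must_return c d -> next d w = Some a -> isRet k a
    & greedy k1 k2 prec (sides s) w].
Proof.
move=> cA; elim: w prec q1 q2 qA c s => [|x w IH] prec q1 q2 qA c s Co U R ok.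
  have Et := stack_ok_top ok; split=> [[_ [-> /= /and3P[f1 f2 tc]]]|].
    split=> //=; [by exists q1|by exists q2| |by case].
    by move: tc; rewrite Et; case: (sides s).
  case=> -[_ [-> f1]] [_ [-> f2]] /= /eqP E _ _.
  by exists (q1, q2, qA, c); rewrite /= f1 f2 Et E.
have pq : prec [::] =2 ord qA by apply: R.
have Co' : contextual_order (shift prec x) by move=> v; apply: Co.
have U' : uniform P1 P2 (shift prec x) by move=> p1 p2 v; apply: U.
have R' qA' s' : step (P := A) qA (stackA s) x qA' (stackA s') ->
    forall v q, reach (P := A) qA' (stackA s') v q -> shift prec x v =2 ord q.
  by move=> stA v q r; apply: R; apply/reach_cons; exists qA', (stackA s').
split.
- case/accepts_cons=> -[[[q1' q2'] qA'] c'] [sB [/(prod_step_inv ok)]].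
  case=> s' [-> ok' [En Es] [stA comp] ck].
  case/(IH _ _ _ _ _ _ Co' U' (R' _ _ stA) ok') => a1 a2 N fl G.
  have {}a1 : accepts_from (P := P1) q1 (stack1 s) (proj1 (x :: w)).
    case: x {IH Co' U' R' stA En Es ck fl G N} comp => b [].
      by move=> st1 _ _; apply/accepts_cons; exists q1', (stack1 s').
    by move=> _ <- <-.
  have {}a2 : accepts_from (P := P2) q2 (stack2 s) (proj2 (x :: w)).
    case: x {IH Co' U' R' stA En Es ck fl G N a1} comp => b [].
      by move=> _ <- <-.
    by move=> st2 _ _; apply/accepts_cons; exists q2', (stack2 s').
  case/and4P: ck => ck1 ck2 ck3 /eqP ck4.
  split=> //=; rewrite -?Es ?En //.
    move=> d a mr; rewrite next_cons; case: eqP => [E [<-]|/eqP dx].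
      by move: ck1; rewrite E mr.
    have Ed : d = ~~ side x by case: d dx {mr}; case: (side x).
    by apply: fl; rewrite Ed ck4 -Ed mr.
  split=> // a Na; rewrite -(postponing_next Co U pq a1 a2 Na) => po.
  rewrite /enabled -(stack_ok_top ok) (next_side Na) negb_imply.
  (* The check on the top excludes the side of [a], and the flag raised in [c'] makes [a] a return,
     so [a] is not enabled. *)
  by rewrite (implyP ck2) // andbT; apply: (fl (~~ side x)); rewrite // ck4 po orbT.
- case=> a1 a2 /[dup] Nxw /= /andP[En N] fl [G1 G2].
  pose p := postponing q1 q2 qA x.
  (* By greediness a smaller letter of the other side is not enabled. *)
  have late a : p -> next (~~ side x) w = Some a ->
      isRet k a && (top c != Some (~~ side x)).
    move=> po Na; have := G1 a Na; rewrite -(postponing_next Co U pq a1 a2 Na).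
    by move=> /(_ po); rewrite /enabled negb_imply -(stack_ok_top ok) (next_side Na).
  (* Clear the flag of the side that moves; keep the other one, raising it if [p] holds. *)
  pose c' : control := (ohead (side_step k1 k2 (sides s) x),
    if side x then (false, c.2.2 || p) else (c.2.1 || p, false)).
  have ck : control_ok p x c c'.
    apply/and4P; split.
    + by apply/implyP => /fl; apply; rewrite next_cons eqxx.
    (* If the other side owned the top, it would still have a letter to come, and its next one would
       be enabled, against [late]. *)
    + apply/implyP => po; apply/eqP => tc.
      have mem : ~~ side x \in sides s.
        move: (stack_ok_top ok); rewrite tc; case: (sides s) => //= d l [->].
        exact: mem_head.
      have [a] := nested_next Nxw mem.
      rewrite next_cons; case: eqP => [|_ Na]; first by case: (side x).
      by have := late _ po Na; rewrite tc eqxx andbF.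
    + by rewrite /c' /must_return; case: (side x).
    + by rewrite /c' /must_return; case: (side x).
  have [qA' [sA' stA]] := complete_step qA (stackA s) x cA.
  have [q1' [q2' [s1' [s2' [comp [b1 b2]]]]]] : exists q1' q2' s1' s2',
      match x with
      | inl a => [/\ step (P := P1) q1 (stack1 s) a q1' s1',
                     q2' = q2 & s2' = stack2 s]
      | inr a => [/\ step (P := P2) q2 (stack2 s) a q2' s2',
                     q1' = q1 & s1' = stack1 s]
      end /\ accepts_from (P := P1) q1' s1' (proj1 w) /\
      accepts_from (P := P2) q2' s2' (proj2 w).
    case: x a1 a2 {IH Co' U' R' Nxw En N fl G1 G2 p late c' ck stA} => a.
      move=> /accepts_cons [q1' [s1' [st1 b1]]] b2.
      by exists q1', q2, s1', (stack2 s).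
    move=> b1 /accepts_cons [q2' [s2' [st2 b2]]].
    by exists q1, q2', (stack1 s), s2'.
  have [s' [st ok' Es EA [E1 E2]]] := prod_step_intro ok En stA comp ck erefl.
  apply/accepts_cons; exists (q1', q2', qA', c'), (map Some s'); split=> //.
  rewrite -EA in stA; apply/(IH _ _ _ _ _ _ Co' U' (R' _ _ stA) ok').
  rewrite E1 E2 Es; split=> // d a; rewrite /c' /must_return /=.
  move=> mr Na; have [Ed|Ed] := eqVneq d (side x).
    by move: mr; rewrite Ed; case: (side x).
  have {}Ed : d = ~~ side x by case: d Ed {mr Na}; case: (side x).
  have /orP[mc|po] : must_return c d || p.
    by move: mr; rewrite Ed /must_return; case: (side x).
  + apply: (fl d) => //; rewrite next_cons Ed.
    by case: eqP; [case: (side x)|rewrite -Ed].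
  + by rewrite Ed in Na; case/andP: (late _ po Na).
Qed.

Lemma card_prod_vpa :
  #|vstate prod_vpa| = 12 * (#|vstate P1| * #|vstate P2| * #|vstate A|).
Proof. by rewrite !card_prod card_option !card_bool mulnC. Qed.

End Product.

(** * The state bound and the recognized language *)

Theorem theorem4p5 :
  exists C : nat,
  forall (S1 S2 : finType) (k1 : S1 -> vkind) (k2 : S2 -> vkind)
         (P1 : vpa k1) (P2 : vpa k2),
    (forall w, lang_of P1 w -> well_matched k1 w) ->
    (forall w, lang_of P2 w -> well_matched k2 w) ->
  forall (prec : seq (S1 + S2) -> rel (S1 + S2)) (A : vpa (sumk k1 k2)),
    contextual_order prec ->
    represents A prec ->
    uniform P1 P2 prec ->
  exists B : vpa (sumk k1 k2),
    #|vstate B| <= C * (#|vstate P1| * #|vstate P2| * #|vstate A|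
                        * (#|vstack P1| + #|vstack P2|)) /\
    forall w, lang_of B w <-> red prec (join k1 k2 (lang_of P1) (lang_of P2)) w.
Proof.
exists 12 => S1 S2 k1 k2 P1 P2 W1 W2 prec A Co [cA [[[qA0 initA] _] [ord [_ ordA]]]] U.
exists (prod_vpa P1 P2 ord); split.
  (* [vbot P1] witnesses that the stack alphabets have at least one symbol in total, so the constant
     12 suffices. *)
  rewrite card_prod_vpa leq_mul2l /= leq_pmulr // addn_gt0.
  by apply/orP; left; apply/card_gt0P; exists (vbot P1).
move=> w; apply: iff_trans (iff_sym (redP w Co W1 W2)).
(* At the start no call is pending and no flag is raised. *)
have sim q1 q2 qA := @prod_accepts _ _ _ _ P1 P2 A ord prec q1 q2 qA
  (None, (false, false)) [::] w cA Co U.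
have R qA : vinit qA -> forall v q, reach (P := A) qA [::] v q -> prec v =2 ord q.
  by move=> iA v q r; apply: ordA; exists qA.
split.
- case/lang_of_accepts=> -[[[q1 q2] qA] c] [/= /and4P[i1 i2 iA /eqP->]].
  case/(sim _ _ _ (R _ iA) (conj erefl I)) => a1 a2 N _ G.
  split=> //; apply/lang_of_accepts; [by exists q1|by exists q2].
- case=> /lang_of_accepts[q1 [i1 a1]] /lang_of_accepts[q2 [i2 a2]] N G.
  have iA : vinit qA0 by apply/initA.
  apply/lang_of_accepts; exists (q1, q2, qA0, (None, (false, false))).
  split; first by rewrite /= i1 i2 iA eqxx.
  apply/(sim _ _ _ (R _ iA) (conj erefl I)); split=> //.
  by case.
Qed.
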